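(* Let $\gamma^2=\operatorname{tr}(\tilde CP\tilde C^T)$ be the squared $H^2$-norm $\|G_N\|_{H^2}^2$ of the Lanczos tau discretization (after elimination of its algebraic part) of the system $E\dot{\mathbf x}(t)=\sum_{k=0}^mA_k\mathbf x(t-\tau_k)+B\mathbf v(t)$, $\mathbf z(t)=C\mathbf x(t)$, regarded as a function of $A_0,\dots,A_m$, $\tau_1,\dots,\tau_m$, $B$, $C$ with $E$ fixed. Assume $\mathcal A_{22}$ is invertible and every generalized eigenvalue of the pencil $\lambda\mathcal E_{11}-\tilde A$ has negative real part. Let $P,Q$ be the solutions of $$\tilde AP\mathcal E_{11}^T+\mathcal E_{11}P\tilde A^T=-\tilde B\tilde B^T,\qquad \tilde A^TQ\mathcal E_{11}+\mathcal E_{11}^TQ\tilde A=-\tilde C^T\tilde C,$$ and set $Q_U=Q(U^\perp-\mathcal A_{12}\mathcal A_{22}^{-1}U)$, $P_V=(V^\perp-V\mathcal A_{22}^{-1}\mathcal A_{21})P$, $W=V\mathcal A_{22}^{-1}U$ and $$\mathcal D_{\mathcal S}=P_V\mathcal E_{11}^TQ_U-W\mathcal B_N\tilde B^TQ_U-P_V\tilde C^T\mathcal C_NW.$$ Then $$\frac{d\gamma^2}{dA_k}=2\begin{pmatrix}I_n\\ \mathbf 0\end{pmatrix}^T\mathcal D_{\mathcal S}^T[\varepsilon_{-\tau_k}]^T\quad(0\le k\le m),$$ $$\frac{d\gamma^2}{d\tau_k}=-2\operatorname{tr}\Big(A_k[\varepsilon_{-\tau_k}\mathcal D]\,\mathcal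 D_{\mathcal S}\begin{pmatrix}I_n\\ \mathbf 0\end{pmatrix}\Big)\quad(1\le k<m),$$ $$\frac{d\gamma^2}{d\tau_m}=-2\operatorname{tr}\Big(\frac1{\tau_m}[\mathcal D]\,\mathcal D_{\mathcal S}\begin{pmatrix}\mathbf 0\\ I_{nN}\end{pmatrix}\Big)-\sum_{k=1}^{m-1}\frac{\tau_k}{\tau_m}\frac{d\gamma^2}{d\tau_k},$$ $$\frac{d\gamma^2}{dB}=2\begin{pmatrix}I_n\\ \mathbf 0\end{pmatrix}^TQ_U^T\tilde B,\qquad \frac{d\gamma^2}{dC}=2\tilde CP_V^T[\varepsilon_0]^T.$$
   Context: **Convention.** For a matrix variable $X$, $\big(\frac{df}{dX}\big)_{ij}=\frac{\partial f}{\partial x_{ij}}$; all derivatives are taken with the other variables held fixed. **System.** $E,A_0,\dots,A_m\in\mathbb R^{n\times n}$, $B\in\mathbb R^{n\times p}$, $C\in\mathbb R^{q\times n}$; $E$ may be singular; $0=\tau_0<\tau_1<\dots<\tau_m<\infty$; the system has differentiation index at most one (if the columns of $\hat V$, $\hat U^T$ form bases of $\ker E$, $\ker E^T$, then $\hat UA_0\hat V$ is nonsingular). **Discretization.** Let $N\ge1$ and let $\{\varphi_j\}_{j=0}^N$ be real degree-graded orthogonal polynomials on $[-\tau_m,0]$ obtained by scaling from a fixed orthogonal family on $[-1,0]$: $\varphi_j(\theta)=\psi_j(\theta/\tau_m)$, with orthogonality with respect to the correspondingly scaled inner product $\langle\cdot,\cdot\rangle$ (given by a positive measure with infinite support). $\mathbb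 P_N^n$ is the space of polynomials of degree at most $N$ from $[-\tau_m,0]$ to $\mathbb C^n$. Define $\varepsilon_\theta\xi=\xi(\theta)$, $\mathcal D\xi=\xi'$, and $\mathcal T_{N-1}:\mathbb P_N^n\to\mathbb P_{N-1}^n$ componentwise by $(\mathcal T_{N-1}\xi)_j=(\xi)_j-\langle(\xi)_j,\varphi_N\rangle\varphi_N/\|\varphi_N\|^2$. $[\,\cdot\,]$ denotes block matrices in coordinates with respect to bases of $\mathbb P_N^n$ and $\mathbb P_{N-1}^n$ that are fixed on $[-1,0]$ and scaled to $[-\tau_m,0]$ (e.g. the $\varphi_j$), so that $[\varepsilon_0]$ and $[\mathcal T_{N-1}]$ do not depend on $\tau_m$. Put $$\mathcal E_N=\begin{pmatrix}E[\varepsilon_0]\\ [\mathcal T_{N-1}]\end{pmatrix},\quad \mathcal A_N=\begin{pmatrix}\sum_{k=0}^mA_k[\varepsilon_{-\tau_k}]\\ [\mathcal D]\end{pmatrix},\quad \mathcal B_N=\begin{pmatrix}B\\ \mathbf 0\end{pmatrix},\quad \mathcal C_N=C[\varepsilon_0].$$ **Elimination.** Let $V$ and $U^T$ be fixed real matrices with orthogonal columns forming bases of $\ker\mathcal E_N$ and $\ker\mathcal E_N^T$; the columns of $V^\perp$ are a basis of the orthogonal complement of the column span of $V$, and the rows of $U^\perp$ a basis of the orthogonal complement of the row span of $U$ (all fixed and real). Set $\mathcal E_{11}=U^\perp\mathcal E_NV^\perp$ (invertible), $\mathcal A_{11}=U^\perp\mathcal A_NV^\perp$, $\mathcal A_{12}=U^\perp\mathcal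 A_NV$, $\mathcal A_{21}=U\mathcal A_NV^\perp$, $\mathcal A_{22}=U\mathcal A_NV$, $\mathcal B_1=U^\perp\mathcal B_N$, $\mathcal B_2=U\mathcal B_N$, $\mathcal C_1=\mathcal C_NV^\perp$, $\mathcal C_2=\mathcal C_NV$, and $\tilde A=\mathcal A_{11}-\mathcal A_{12}\mathcal A_{22}^{-1}\mathcal A_{21}$, $\tilde B=\mathcal B_1-\mathcal A_{12}\mathcal A_{22}^{-1}\mathcal B_2$, $\tilde C=\mathcal C_1-\mathcal C_2\mathcal A_{22}^{-1}\mathcal A_{21}$. The quantity $\operatorname{tr}(\tilde CP\tilde C^T)$ equals $\|G_N\|_{H^2}^2$ when $\tilde D=-\mathcal C_2\mathcal A_{22}^{-1}\mathcal B_2=\mathbf 0$. *)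

(* Defs.v *)
From HB Require Import structures.
From mathcomp Require Import all_boot all_order all_algebra.
From mathcomp Require Import all_classical all_reals all_analysis.
From mathcomp Require Import complex.

Set Implicit Arguments.
Unset Strict Implicit.
Unset Printing Implicit Defensive.

Import Order.TTheory GRing.Theory Num.Theory.
Import numFieldNormedType.Exports.

Local Open Scope classical_set_scope.
Local Open Scope ring_scope.

(* The columns of V form a basis of {x | K x = 0}.  MathComp kernels are row
   kernels, whence the transposes. *)
Definition ker_basis (R : fieldType) (k l d : nat)
    (K : 'M[R]_(k, l)) (V : 'M[R]_(l, d)) : Prop :=
  row_free V^T /\ (V^T == kermx K^T)%MS.

(* The columns of W form a basis of the orthogonal complement of the column
   span of V, which is {x | V^T x = 0}. *)
Definition orthc_basis (R : fieldType) (l d e : nat)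
    (V : 'M[R]_(l, d)) (W : 'M[R]_(l, e)) : Prop :=
  ker_basis V^T W.

(* For nonsingular E there is only d = 0, and the empty matrix is in unitmx. *)
Definition index_le1 (R : fieldType) (n : nat) (E A0 : 'M[R]_n) : Prop :=
  forall (d : nat) (Vh : 'M[R]_(n, d)) (Uh : 'M[R]_(d, n)),
    ker_basis E Vh -> ker_basis E^T Uh^T -> Uh *m A0 *m Vh \in unitmx.

(* lam is a generalized eigenvalue of the real pencil lam E - A. *)
Definition gen_eigenvalue (R : rcfType) (s : nat) (E A : 'M[R]_s)
    (lam : R[i]) : Prop :=
  exists2 v : 'cV[R[i]]_s, v != 0 &
    (lam *: map_mx (real_complex R) E - map_mx (real_complex R) A) *m v = 0.

Definition is_basis (R : nzRingType) (V : lmodType R) (d : nat)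
    (S : set V) (b : 'I_d -> V) : Prop :=
  (forall j, S (b j)) /\
  (forall v, S v -> exists! c : 'rV[R]_d, v = \sum_j c ord0 j *: b j).

(* R^n-valued polynomials. *)
Notation vpoly R n := {ffun 'I_n -> {poly R}}.

Definition vpoly_deg_le (R : nzRingType) (n N : nat) : set (vpoly R n) :=
  [set xi : vpoly R n | forall i, (size (xi i) <= N.+1)%N].

(* Matrix of an operator L with respect to the bases b and b'. *)
Definition op_mx (R : realType) (V W : lmodType R) (c d : nat)
    (b : 'I_c -> V) (b' : 'I_d -> W) (L : V -> W) : 'M[R]_(d, c) :=
  xget 0 [set M : 'M[R]_(d, c) | forall j, L (b j) = \sum_i M i j *: b' i].

(* Matrix of an operator with values in R^n (standard basis). *)
Definition ev_mx (R : nzRingType) (V : lmodType R) (c n : nat)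
    (b : 'I_c -> V) (L : V -> 'cV[R]_n) : 'M[R]_(n, c) :=
  \matrix_(i, j) L (b j) i ord0.

(* From [-1, 0] to [-t, 0]: the polynomial theta |-> p (theta / t). *)
Definition pscale (R : fieldType) (t : R) (p : {poly R}) : {poly R} :=
  p \Po (t^-1 *: 'X).

Definition vscale (R : fieldType) (n : nat) (t : R) (xi : vpoly R n) :
    vpoly R n :=
  [ffun i => pscale t (xi i)].

Definition eval_op (R : nzRingType) (n : nat) (th : R) (xi : vpoly R n) :
    'cV[R]_n :=
  \col_i (xi i).[th].

Definition deriv_op (R : nzRingType) (n : nat) (xi : vpoly R n) : vpoly R n :=
  [ffun i => (xi i)^`()].

Definition msupport (R : realType)
    (mu : {finite_measure set (measurableTypeR R) -> \bar R}) : set R :=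
  [set x | forall e : R, 0 < e -> (0 < mu (ball x e))%E].

(* Inner product on [-t, 0] obtained by scaling the one of mu on [-1, 0]; a
   constant factor such as t would cancel in the truncation below. *)
Definition inner (R : realType)
    (mu : {finite_measure set (measurableTypeR R) -> \bar R}) (t : R)
    (f g : {poly R}) : R :=
  \int[mu]_(x in `[-1, 0]) (f.[t * x] * g.[t * x]).

(* Degree-graded orthogonal polynomials psi_0, ..., psi_N on [-1, 0]. *)
Definition orthogonal_family (R : realType) (N : nat)
    (mu : {finite_measure set (measurableTypeR R) -> \bar R})
    (psi : 'I_N.+1 -> {poly R}) : Prop :=
  [/\ mu (~` `[-1, 0]) = 0%E,
      infinite_set (msupport mu),
      forall j, size (psi j) = j.+1 &
      forall i j, i != j -> inner mu 1 (psi i) (psi j) = 0].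

Definition trunc_op (R : realType) (n N : nat)
    (mu : {finite_measure set (measurableTypeR R) -> \bar R})
    (psi : 'I_N.+1 -> {poly R}) (t : R) (xi : vpoly R n) : vpoly R n :=
  let phiN := pscale t (psi ord_max) in
  [ffun i => xi i - (inner mu t (xi i) phiN / inner mu t phiN phiN) *: phiN].

(* Coordinate matrices on [-t, 0], in the scaled bases b (theta / t) and
   b' (theta / t). *)
Definition eval_mx (R : realType) (n N : nat)
    (b : 'I_(n + n * N) -> vpoly R n) (t th : R) : 'M[R]_(n, n + n * N) :=
  ev_mx (vscale t \o b) (eval_op th).

Definition eval_deriv_mx (R : realType) (n N : nat)
    (b : 'I_(n + n * N) -> vpoly R n) (t th : R) : 'M[R]_(n, n + n * N) :=
  ev_mx (vscale t \o b) (eval_op th \o @deriv_op R n).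

Definition deriv_mx (R : realType) (n N : nat)
    (b : 'I_(n + n * N) -> vpoly R n) (b' : 'I_(n * N) -> vpoly R n) (t : R) :
    'M[R]_(n * N, n + n * N) :=
  op_mx (vscale t \o b) (vscale t \o b') (@deriv_op R n).

Definition trunc_mx (R : realType) (n N : nat)
    (mu : {finite_measure set (measurableTypeR R) -> \bar R})
    (psi : 'I_N.+1 -> {poly R})
    (b : 'I_(n + n * N) -> vpoly R n) (b' : 'I_(n * N) -> vpoly R n) (t : R) :
    'M[R]_(n * N, n + n * N) :=
  op_mx (vscale t \o b) (vscale t \o b') (trunc_op mu psi t).

Definition tauE (R : realType) (n N : nat)
    (mu : {finite_measure set (measurableTypeR R) -> \bar R})
    (psi : 'I_N.+1 -> {poly R})
    (b : 'I_(n + n * N) -> vpoly R n) (b' : 'I_(n * N) -> vpoly R n)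
    (E : 'M[R]_n) (t : R) : 'M[R]_(n + n * N) :=
  col_mx (E *m eval_mx b t 0) (trunc_mx mu psi b b' t).

Definition tauA (R : realType) (n N m : nat)
    (b : 'I_(n + n * N) -> vpoly R n) (b' : 'I_(n * N) -> vpoly R n)
    (A : 'I_m.+1 -> 'M[R]_n) (tau : 'I_m.+1 -> R) : 'M[R]_(n + n * N) :=
  col_mx (\sum_k A k *m eval_mx b (tau ord_max) (- tau k))
         (deriv_mx b b' (tau ord_max)).

Definition tauB (R : realType) (n N p : nat) (B : 'M[R]_(n, p)) :
    'M[R]_(n + n * N, p) :=
  col_mx B 0.

Definition tauC (R : realType) (n N q : nat)
    (b : 'I_(n + n * N) -> vpoly R n) (C : 'M[R]_(q, n)) (t : R) :
    'M[R]_(q, n + n * N) :=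
  C *m eval_mx b t 0.

Definition redA (R : realType) (M r s : nat)
    (U : 'M[R]_(r, M)) (V : 'M[R]_(M, r))
    (Up : 'M[R]_(s, M)) (Vp : 'M[R]_(M, s)) (AN : 'M[R]_M) : 'M[R]_s :=
  Up *m AN *m Vp -
  (Up *m AN *m V) *m invmx (U *m AN *m V) *m (U *m AN *m Vp).

Definition redB (R : realType) (M r s p : nat)
    (U : 'M[R]_(r, M)) (V : 'M[R]_(M, r)) (Up : 'M[R]_(s, M))
    (AN : 'M[R]_M) (BN : 'M[R]_(M, p)) : 'M[R]_(s, p) :=
  Up *m BN - (Up *m AN *m V) *m invmx (U *m AN *m V) *m (U *m BN).

Definition redC (R : realType) (M r s q : nat)
    (U : 'M[R]_(r, M)) (V : 'M[R]_(M, r)) (Vp : 'M[R]_(M, s))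
    (AN : 'M[R]_M) (CN : 'M[R]_(q, M)) : 'M[R]_(q, s) :=
  CN *m Vp - (CN *m V) *m invmx (U *m AN *m V) *m (U *m AN *m Vp).

Definition lyapP (R : realType) (s p : nat) (E A : 'M[R]_s) (B : 'M[R]_(s, p))
    (P : 'M[R]_s) : Prop :=
  A *m P *m E^T + E *m P *m A^T = - (B *m B^T).

Definition lyapQ (R : realType) (s q : nat) (E A : 'M[R]_s) (C : 'M[R]_(q, s))
    (Q : 'M[R]_s) : Prop :=
  A^T *m Q *m E + E^T *m Q *m A = - (C^T *m C).

(* gamma^2 = tr (Ct P Ct^T), as a function of A, tau, B, C.  The Lyapunov
   equation has exactly one solution P as soon as the pencil is stable. *)
Definition gamma2 (R : realType) (n p q m N r s : nat)
    (mu : {finite_measure set (measurableTypeR R) -> \bar R})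
    (psi : 'I_N.+1 -> {poly R})
    (b : 'I_(n + n * N) -> vpoly R n) (b' : 'I_(n * N) -> vpoly R n)
    (U : 'M[R]_(r, n + n * N)) (V : 'M[R]_(n + n * N, r))
    (Up : 'M[R]_(s, n + n * N)) (Vp : 'M[R]_(n + n * N, s))
    (E : 'M[R]_n) (A : 'I_m.+1 -> 'M[R]_n) (tau : 'I_m.+1 -> R)
    (B : 'M[R]_(n, p)) (C : 'M[R]_(q, n)) : R :=
  let EN := tauE mu psi b b' E (tau ord_max) in
  let AN := tauA b b' A tau in
  let Ct := redC U V Vp AN (tauC b C (tau ord_max)) in
  let P := xget 0 [set P | lyapP (Up *m EN *m Vp) (redA U V Up Vp AN)
                                 (redB U V Up AN (tauB N B)) P] in
  \tr (Ct *m P *m Ct^T).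

Definition upd (m : nat) (T : Type) (f : 'I_m -> T) (k : 'I_m) (x : T) :
    'I_m -> T :=
  fun j => if j == k then x else f j.

(* dF/dX = G at X: every partial derivative dF/dx_ij exists and is G i j. *)
Definition is_mx_derive (R : realType) (k l : nat) (F : 'M[R]_(k, l) -> R)
    (X G : 'M[R]_(k, l)) : Prop :=
  forall i j,
    is_derive (0 : R) (1 : R) (fun h : R => F (X + h *: delta_mx i j)) (G i j).

(* Main.v *)
Require Import Defs.
From HB Require Import structures.
From mathcomp Require Import all_boot all_order all_algebra.
From mathcomp Require Import all_classical all_reals all_analysis.
From mathcomp Require Import complex ring.

Set Implicit Arguments.
Unset Strict Implicit.
Unset Printing Implicit Defensive.

Import Order.TTheory GRing.Theory Num.Theory.
Import numFieldNormedType.Exports.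

Local Open Scope classical_set_scope.
Local Open Scope ring_scope.

(** The parameters A_k, tau_k, B, C enter gamma^2 only through the matrices
    AN, BN, CN of the discretization: in scaled coordinates EN is the same for
    every tau_m > 0 ([trunc_mx_cst], [eval_mx0]).  It therefore suffices to
    differentiate gamma^2 along an arbitrary curve of triples (AN, BN, CN),
    which is done once in [derive_reduced_norm]:
      d gamma^2 = 2 tr (AN' DS) + 2 tr (BN' Bt^T QU) + 2 tr (CN' PV Ct^T).
    The five formulas are this one read off for the curves along which a
    single parameter moves.

    The formula itself has two sources.  First, At is a Schur complement, and
    with L = Up - A12 A22^-1 U, K = Vp - V A22^-1 A21, W = V A22^-1 U the
    derivatives of the reduced matrices factor as At' = L AN' K,
    Bt' = L BN' - L AN' W BN, Ct' = CN' K - CN W AN' K ([curve_redA],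
    [curve_redB], [curve_redC]).  Second, the derivative P' of the Gramian
    solves the Lyapunov equation differentiated along the curve, and Q solves
    the adjoint equation, so that tr (Ct P' Ct^T) can be rewritten without P'
    ([lyapQ_adjoint], [derive_lyap_trace]).

    What has to be known beforehand is that P depends differentiably on the
    curve.  The Lyapunov operator is invertible at the base point
    ([lyap_inj]): there E11 is invertible since EN maps the complement of its
    kernel isomorphically onto its range ([compression_unit]), and the
    spectrum of E11^-1 At is disjoint from its negative, which by
    Cayley-Hamilton forbids nonzero solutions of the homogeneous equation
    ([sylvester_inj]).  Invertibility persists nearby, where P is then given
    by an inverse matrix, whose entries are quotients of determinants
    ([curve_lyap_sol], [curve_invmx]). *)

(** * Uniqueness for Lyapunov equations of stable pencils *)

(** M X = X N gives p(M) X = X p(N) for every polynomial p.  For p the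
    characteristic polynomial of M the left side vanishes, while p(N) is a
    product of invertible factors N - a. *)
Lemma sylvester_inj (F : closedFieldType) (s : nat) (M N X : 'M[F]_s) :
  (forall a, root (char_poly M) a -> N - a%:M \in unitmx) ->
  M *m X = X *m N -> X = 0.
Proof.
case: s => [|s] in M N X *; first by move=> _ _; rewrite flatmx0.
move=> specN MX.
have [rs charM] := closed_field_poly_normal (char_poly M).
rewrite (monicP (char_poly_monic M)) scale1r in charM.
have rootM : {in rs, forall a, N - a%:M \in unitmx}.
  by move=> a ars; apply: specN; rewrite charM root_prod_XsubC.
have prodE (K : 'M[F]_s.+1) :
    horner_mx K (char_poly M) = \prod_(a <- rs) (K - a%:M).
  rewrite charM rmorph_prod; apply: eq_bigr => a _.
  by rewrite rmorphB /= horner_mx_X horner_mx_C.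
have shift_prod : (\prod_(a <- rs) (M - a%:M)) *m X
    = X *m \prod_(a <- rs) (N - a%:M).
  elim: rs {charM rootM prodE} => [|a rs IH].
    by rewrite !big_nil mul1mx mulmx1.
  rewrite !big_cons -!mulmxE -mulmxA IH !mulmxA mulmxBl mulmxBr MX.
  by rewrite scalar_mxC.
have prodN_unit : \prod_(a <- rs) (N - a%:M) \in unitmx.
  elim: rs rootM {charM prodE shift_prod} => [|a rs IH] rootM.
    by rewrite big_nil unitmx1.
  rewrite big_cons -mulmxE unitmx_mul rootM ?mem_head //=.
  by apply: IH => c crs; apply: rootM; rewrite in_cons crs orbT.
move: shift_prod; rewrite -prodE Cayley_Hamilton mul0mx => /esym X0.
by rewrite -[X](mulmxK prodN_unit) X0 mul0mx.
Qed.

(** Stability in the form in which it is used: invertibility of lam E - A on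
    the closed right half plane, a condition invariant under transposition. *)
Definition stable_pencil (R : rcfType) (s : nat) (E A : 'M[R]_s) : Prop :=
  forall lam : R[i], 0 <= complex.Re lam ->
    lam *: map_mx (real_complex R) E - map_mx (real_complex R) A \in unitmx.

Lemma stable_pencilP (R : rcfType) (s : nat) (E A : 'M[R]_s) :
  (forall lam : R[i], gen_eigenvalue E A lam -> complex.Re lam < 0) ->
  stable_pencil E A.
Proof.
move=> neg lam lam0; rewrite unitmxE unitfE -det_tr; apply/negP => /det0P[v v0].
move=> /(congr1 trmx); rewrite trmx_mul trmxK trmx0 => pencil_v.
suff /neg : gen_eigenvalue E A lam by rewrite ltNge lam0.
by exists v^T => //; rewrite -trmx0 (inj_eq trmx_inj).
Qed.

Lemma stable_pencil_tr (R : rcfType) (s : nat) (E A : 'M[R]_s) :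
  stable_pencil E A -> stable_pencil E^T A^T.
Proof.
move=> st lam /st; rewrite -unitmx_tr linearB /= linearZ /=.
by rewrite -!map_trmx.
Qed.

(** With M = E^-1 A the equation reads M X = X (- M^T); the eigenvalues of M
    lie in the open left half plane, those of - M^T in the right one. *)
Lemma lyap_inj (R : rcfType) (s : nat) (E A X : 'M[R]_s) :
  E \in unitmx -> stable_pencil E A ->
  A *m X *m E^T + E *m X *m A^T = 0 -> X = 0.
Proof.
move=> Eu st eq0; apply: (map_mx_inj (f := real_complex R)).
pose toC (K : 'M[R]_s) := map_mx (real_complex R) K.
rewrite map_mx0 -/(toC X).
have ECu : toC E \in unitmx by rewrite map_unitmx.
pose M := invmx E *m A.
have pencilE a : a *: toC E - toC A = toC E *m (a%:M - toC M).
  rewrite mulmxBr mul_mx_scalar /M /toC map_mxM map_invmx -!/(toC _) mulmxA.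
  by rewrite mulmxV // mul1mx.
have Mu a : 0 <= complex.Re a -> a%:M - toC M \in unitmx.
  by move=> /st; rewrite -!/(toC _) pencilE unitmx_mul ECu.
apply: (@sylvester_inj _ _ (toC M) (- (toC M)^T)) => [a rootM|].
  have -> : - (toC M)^T - a%:M = ((- a)%:M - toC M)^T.
    by rewrite linearB /= tr_scalar_mx addrC raddfN.
  rewrite unitmx_tr Mu // raddfN /= oppr_ge0 leNgt.
  apply/negP => /ltW /Mu; rewrite unitmxE unitfE.
  move: rootM; rewrite -eigenvalue_root_char => /eigenvalueP[v vM v0].
  move/negP; apply.
  by apply/det0P; exists v => //; rewrite mulmxBr vM mul_mx_scalar subrr.
rewrite /toC map_trmx -raddfN -!map_mxM; congr map_mx.
apply/eqP; rewrite mulmxN -subr_eq0 opprK.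
have ETu : E^T \in unitmx by rewrite unitmx_tr.
have := congr1 (fun K => invmx E *m K *m invmx E^T) eq0.
rewrite mulmx0 mul0mx mulmxDr mulmxDl => <-; apply/eqP; congr (_ + _).
  by rewrite /M -!mulmxA mulmxV // mulmx1.
by rewrite /M !mulmxA mulVmx // mul1mx trmx_mul trmx_inv mulmxA.
Qed.

(** * Invertibility of the compression of EN *)

Lemma mulmx_tr_eq0 (R : realDomainType) (k l : nat) (K : 'M[R]_(k, l)) :
  K^T *m K = 0 -> K = 0.
Proof.
move=> KK0; apply/matrixP => i j; have := congr1 (fun Z : 'M[R]_l => Z j j) KK0.
rewrite !mxE => /eqP; rewrite psumr_eq0 => [/allP/(_ i)|i' _]; last first.
  by rewrite mxE -expr2 sqr_ge0.
by rewrite mem_index_enum mxE mulf_eq0 orbb => /(_ isT)/eqP.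
Qed.

Lemma ker_basis_mul0 (R : fieldType) (k l d : nat) (K : 'M[R]_(k, l))
    (V : 'M[R]_(l, d)) : ker_basis K V -> K *m V = 0.
Proof.
case=> _ /andP[/sub_kermxP VK _].
by apply: trmx_inj; rewrite trmx_mul VK trmx0.
Qed.

Lemma ker_basis_lift (R : fieldType) (k l d e : nat) (K : 'M[R]_(k, l))
    (V : 'M[R]_(l, d)) (Y : 'M[R]_(l, e)) :
  ker_basis K V -> K *m Y = 0 -> exists Z, Y = V *m Z.
Proof.
case=> _ /andP[_ kerV] KY0.
have : (Y^T <= V^T)%MS.
  apply: submx_trans kerV; apply/sub_kermxP.
  by rewrite -trmx_mul KY0 trmx0.
by case/submxP => Z YZ; exists Z^T; apply: trmx_inj; rewrite trmx_mul trmxK.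
Qed.

Lemma ker_basis_inj (R : fieldType) (k l d e : nat) (K : 'M[R]_(k, l))
    (V : 'M[R]_(l, d)) (Z : 'M[R]_(d, e)) :
  ker_basis K V -> V *m Z = 0 -> Z = 0.
Proof.
case=> freeV _ VZ0; apply: trmx_inj; apply: (row_free_inj freeV).
by rewrite /= -!trmx_mul VZ0 mulmx0.
Qed.

(** The columns of Y lie both in the column span of W and in its orthogonal
    complement, which meet in 0 over a real field. *)
Lemma orthc_basis_meet0 (R : realFieldType) (l d e f : nat) (V : 'M[R]_(l, d))
    (W : 'M[R]_(l, e)) (Y : 'M[R]_(l, f)) :
  orthc_basis V W -> V^T *m Y = 0 -> W^T *m Y = 0 -> Y = 0.
Proof.
move=> Wb VY0 WY0; have [Z YZ] := ker_basis_lift Wb VY0.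
by apply: mulmx_tr_eq0; rewrite {1}YZ trmx_mul -mulmxA WY0 mulmx0.
Qed.

(** If Up K Vp v = 0 then K Vp v is orthogonal to the span of Up^T, and also to
    that of U^T because U K = 0; hence it is 0.  So Vp v lies in ker K, to
    which it is orthogonal, and v = 0 as the columns of Vp are independent. *)
Lemma compression_unit (R : realFieldType) (M r s : nat) (K : 'M[R]_M)
    (U : 'M[R]_(r, M)) (V : 'M[R]_(M, r)) (Up : 'M[R]_(s, M))
    (Vp : 'M[R]_(M, s)) :
  ker_basis K V -> ker_basis K^T U^T -> orthc_basis V Vp ->
  orthc_basis U^T Up^T -> Up *m K *m Vp \in unitmx.
Proof.
move=> Vb Ub Vpb Upb; rewrite -unitmx_tr unitmxE unitfE.
apply/negP => /det0P[v /eqP v0].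
move=> /(congr1 trmx); rewrite trmx_mul trmxK trmx0 => Ev0; apply: v0.
have UK : U *m K = 0.
  by apply: trmx_inj; rewrite trmx_mul (ker_basis_mul0 Ub) trmx0.
have KVpv : K *m (Vp *m v^T) = 0.
  apply: (orthc_basis_meet0 Upb); rewrite trmxK.
    by rewrite mulmxA UK mul0mx.
  by rewrite !mulmxA.
have [y Vpvy] := ker_basis_lift Vb KVpv.
have Vy0 : V *m y = 0.
  apply: mulmx_tr_eq0; rewrite trmx_mul -Vpvy -mulmxA [V^T *m _]mulmxA.
  by rewrite (ker_basis_mul0 Vpb) mul0mx mulmx0.
rewrite Vy0 in Vpvy.
by apply: trmx_inj; rewrite trmx0; apply: (ker_basis_inj Vpb).
Qed.

(** * Entrywise derivatives of curves of matrices *)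

Lemma is_derive_bigsum (R : realType) (I : Type) (r : seq I) (P : pred I)
    (x : R) (f : I -> R -> R) (df : I -> R) :
  (forall i, P i -> is_derive x 1 (f i) (df i)) ->
  is_derive x 1 (fun h => \sum_(i <- r | P i) f i h) (\sum_(i <- r | P i) df i).
Proof.
move=> fdf; elim: r => [|i r IH].
  rewrite big_nil; under eq_fun do rewrite big_nil; exact: is_derive_cst.
rewrite big_cons; under eq_fun do rewrite big_cons.
by case: ifP => // Pi; apply: is_deriveD => //; exact: fdf.
Qed.

Lemma derivable_bigprod (R : realType) (I : Type) (r : seq I) (x : R)
    (f : I -> R -> R) :
  (forall i, derivable (f i) x 1) ->
  derivable (fun h => \prod_(i <- r) f i h) x 1.
Proof.
move=> df; elim: r => [|i r IH].
  under eq_fun do rewrite big_nil; exact: derivable_cst.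
under eq_fun do rewrite big_cons; exact: derivableM.
Qed.

(** Entrywise, so that matrices of every size, empty ones included, are covered
    at once. *)
Definition is_derive_curve (R : realType) (k l : nat) (F : R -> 'M[R]_(k, l))
    (x : R) (D : 'M[R]_(k, l)) : Prop :=
  forall i j, is_derive x 1 (fun h => F h i j) (D i j).

Section Curves.
Variables (R : realType) (x : R).

Lemma near_curve (k l : nat) (F G : R -> 'M[R]_(k, l)) D :
  (\forall h \near x, F h = G h) ->
  is_derive_curve F x D -> is_derive_curve G x D.
Proof.
move=> FG dF i j; apply: near_eq_is_derive (dF i j).
by apply: filterS FG => h ->.
Qed.

Lemma curve_eqD (k l : nat) (F : R -> 'M[R]_(k, l)) D D' :
  is_derive_curve F x D -> D = D' -> is_derive_curve F x D'.
Proof. by move=> dF <-. Qed.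

Lemma curve_unique (k l : nat) (F : R -> 'M[R]_(k, l)) D D' :
  is_derive_curve F x D -> is_derive_curve F x D' -> D = D'.
Proof.
move=> dF dF'; apply/matrixP => i j.
by rewrite -(@derive_val _ _ _ _ _ _ _ (dF i j))
  (@derive_val _ _ _ _ _ _ _ (dF' i j)).
Qed.

Lemma curve_cst (k l : nat) (K : 'M[R]_(k, l)) : is_derive_curve (fun=> K) x 0.
Proof. by move=> i j; rewrite mxE; exact: is_derive_cst. Qed.

Lemma curveD (k l : nat) (F G : R -> 'M[R]_(k, l)) DF DG :
  is_derive_curve F x DF -> is_derive_curve G x DG ->
  is_derive_curve (fun h => F h + G h) x (DF + DG).
Proof.
move=> dF dG i j; rewrite mxE; under eq_fun do rewrite mxE.
exact: is_deriveD.
Qed.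

Lemma curveN (k l : nat) (F : R -> 'M[R]_(k, l)) D :
  is_derive_curve F x D -> is_derive_curve (fun h => - F h) x (- D).
Proof.
by move=> dF i j; rewrite mxE; under eq_fun do rewrite mxE; exact: is_deriveN.
Qed.

Lemma curveB (k l : nat) (F G : R -> 'M[R]_(k, l)) DF DG :
  is_derive_curve F x DF -> is_derive_curve G x DG ->
  is_derive_curve (fun h => F h - G h) x (DF - DG).
Proof. by move=> dF dG; apply: curveD => //; apply: curveN. Qed.

Lemma curve_tr (k l : nat) (F : R -> 'M[R]_(k, l)) D :
  is_derive_curve F x D -> is_derive_curve (fun h => (F h)^T) x D^T.
Proof.
by move=> dF i j; rewrite mxE; under eq_fun do rewrite mxE; exact: dF.
Qed.

Lemma curveM (k l o : nat) (F : R -> 'M[R]_(k, l)) (G : R -> 'M[R]_(l, o))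
    DF DG :
  is_derive_curve F x DF -> is_derive_curve G x DG ->
  is_derive_curve (fun h => F h *m G h) x (DF *m G x + F x *m DG).
Proof.
move=> dF dG i j; rewrite !mxE -big_split /=; under eq_fun do rewrite mxE.
apply: is_derive_bigsum => a _.
apply: is_derive_eq (is_deriveM (dF i a) (dG a j)) _.
by rewrite addrC; congr (_ + _); rewrite /GRing.scale /= mulrC.
Qed.

Lemma curveMl (k l o : nat) (K : 'M[R]_(k, l)) (G : R -> 'M[R]_(l, o)) D :
  is_derive_curve G x D -> is_derive_curve (fun h => K *m G h) x (K *m D).
Proof.
move=> dG; apply: curve_eqD (curveM (curve_cst K) dG) _.
by rewrite mul0mx add0r.
Qed.

Lemma curveMr (k l o : nat) (F : R -> 'M[R]_(k, l)) (K : 'M[R]_(l, o)) D :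
  is_derive_curve F x D -> is_derive_curve (fun h => F h *m K) x (D *m K).
Proof.
move=> dF; apply: curve_eqD (curveM dF (curve_cst K)) _.
by rewrite mulmx0 addr0.
Qed.

Lemma curve_col_mx (k k' l : nat) (F : R -> 'M[R]_(k, l))
    (G : R -> 'M[R]_(k', l)) DF DG :
  is_derive_curve F x DF -> is_derive_curve G x DG ->
  is_derive_curve (fun h => col_mx (F h) (G h)) x (col_mx DF DG).
Proof.
move=> dF dG i j; rewrite -(splitK i); case: (fintype.split i) => a /=.
  by rewrite col_mxEu; under eq_fun do rewrite col_mxEu; exact: dF.
by rewrite col_mxEd; under eq_fun do rewrite col_mxEd; exact: dG.
Qed.

Lemma curve_sum (I : Type) (r : seq I) (P : pred I) (k l : nat)
    (F : I -> R -> 'M[R]_(k, l)) D :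
  (forall a, P a -> is_derive_curve (F a) x (D a)) ->
  is_derive_curve (fun h => \sum_(a <- r | P a) F a h) x
    (\sum_(a <- r | P a) D a).
Proof.
move=> dF i j; rewrite summxE; under eq_fun do rewrite summxE.
by apply: is_derive_bigsum => a Pa; exact: dF.
Qed.

Lemma is_derive_mxtrace (k : nat) (F : R -> 'M[R]_k) D :
  is_derive_curve F x D -> is_derive x 1 (fun h => \tr (F h)) (\tr D).
Proof. by move=> dF; apply: is_derive_bigsum => i _; exact: dF. Qed.

Lemma derivable_det (k : nat) (F : R -> 'M[R]_k) :
  (forall i j, derivable (fun h => F h i j) x 1) ->
  derivable (fun h => \det (F h)) x 1.
Proof.
move=> dF; rewrite /determinant; apply: ex_derive.
apply: is_derive_bigsum => s _; apply: derivableP.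
apply: derivableM; first exact: derivable_cst.
exact: derivable_bigprod.
Qed.

Lemma curve_derivable (k l : nat) (F : R -> 'M[R]_(k, l)) D :
  is_derive_curve F x D -> forall i j, derivable (fun h => F h i j) x 1.
Proof. by move=> dF i j; case: (dF i j). Qed.

Lemma near_unitmx (k : nat) (F : R -> 'M[R]_k) :
  (forall i j, derivable (fun h => F h i j) x 1) ->
  F x \in unitmx -> \forall h \near x, F h \in unitmx.
Proof.
move=> /derivable_det /derivable1_diffP /differentiable_continuous detF.
rewrite unitmxE unitfE => det0.
have detn0 : \forall h \near x, \det (F h) != 0 by exact: cvgr_neq0 detF det0.
by apply: filterS detn0 => h; rewrite unitmxE unitfE.
Qed.

(** Cramer's rule makes the inverse derivable near x; the value of the
    derivative is then forced by differentiating F F^-1 = 1. *)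
Lemma curve_invmx (k : nat) (F : R -> 'M[R]_k) D :
  is_derive_curve F x D -> F x \in unitmx ->
  is_derive_curve (fun h => invmx (F h)) x
    (- (invmx (F x) *m D *m invmx (F x))).
Proof.
move=> dF Fu; have derF := curve_derivable dF.
have Fnear := near_unitmx derF Fu.
have [G dG] : exists G, is_derive_curve (fun h => invmx (F h)) x G.
  exists (\matrix_(i, j) 'D_1 (fun h => invmx (F h) i j) x) => i j.
  rewrite mxE; apply: derivableP.
  apply: (near_eq_derivable 
    (f := fun h => (\det (F h))^-1 * cofactor (F h) j i)).
    by apply: filterS Fnear => h Fhu; rewrite /invmx Fhu !mxE.
  apply: derivableM.
    by apply: derivableV; [rewrite -unitfE -unitmxE|exact: derivable_det].
  apply: derivableM; first exact: derivable_cst.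
  by apply: derivable_det => a c; under eq_fun do rewrite !mxE; exact: derF.
have : D *m invmx (F x) + F x *m G = 0.
  apply: curve_unique (curve_cst 1%:M).
  apply: near_curve (curveM dF dG).
  by apply: filterS Fnear => h Fhu; rewrite mulmxV.
move/(congr1 (mulmx (invmx (F x)))); rewrite mulmx0 mulmxDr mulKmx // mulmxA.
by move/eqP; rewrite addrC addr_eq0 => /eqP <-.
Qed.

End Curves.

(** * Differentiating the solution of a Lyapunov equation *)

Definition lyap_op (R : comNzRingType) (s : nat) (E A X : 'M[R]_s) : 'M[R]_s :=
  A *m X *m E^T + E *m X *m A^T.

Lemma lyap_op_linear (R : comNzRingType) (s : nat) (E A : 'M[R]_s) :
  linear (lyap_op E A).
Proof.
move=> a X Y; rewrite /lyap_op scalerDr addrACA.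
by rewrite !mulmxDr !mulmxDl -!scalemxAr -!scalemxAl.
Qed.

HB.instance Definition _ (R : comNzRingType) (s : nat) (E A : 'M[R]_s) :=
  GRing.isLinear.Build R 'M[R]_s 'M[R]_s _ (lyap_op E A) (lyap_op_linear E A).

(** In coordinates, invertibility of the Lyapunov operator is the nonvanishing
    of a determinant, an open condition. *)
Definition lyap_mx (R : comNzRingType) (s : nat) (E A : 'M[R]_s) :
    'M[R]_(s * s) := lin_mx (lyap_op E A).

Lemma lyap_mx_unit (R : rcfType) (s : nat) (E A : 'M[R]_s) :
  E \in unitmx -> stable_pencil E A -> lyap_mx E A \in unitmx.
Proof.
move=> Eu st; rewrite unitmxE unitfE; apply/negP => /det0P[v /eqP v0].
rewrite -(vec_mxK v) mul_vec_lin => /eqP; rewrite mxvec_eq0 => /eqP Lv0.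
by apply: v0; rewrite -(vec_mxK v) (lyap_inj Eu st Lv0) linear0.
Qed.

Lemma lyap_mxP (R : realType) (s p : nat) (E A X : 'M[R]_s) (B : 'M[R]_(s, p)) :
  lyap_mx E A \in unitmx ->
  lyapP E A B X <-> X = vec_mx (mxvec (- (B *m B^T)) *m invmx (lyap_mx E A)).
Proof.
move=> Lu; rewrite /lyapP -/(lyap_op E A X); split => [<-|->].
  by rewrite -mul_vec_lin mulmxK // mxvecK.
by apply: (can_inj mxvecK); rewrite -mul_vec_lin vec_mxK mulmxKV.
Qed.

Section LyapunovCurve.
Variables (R : realType) (x : R).

Lemma curve_mxvec (k l : nat) (F : R -> 'M[R]_(k, l)) D :
  is_derive_curve F x D -> is_derive_curve (fun h => mxvec (F h)) x (mxvec D).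
Proof.
move=> dF i j; rewrite (ord1 i); case/mxvec_indexP: j => a c.
by rewrite mxvecE; under eq_fun do rewrite mxvecE; exact: dF.
Qed.

Lemma curve_vec_mx (k l : nat) (F : R -> 'rV[R]_(k * l)) D :
  is_derive_curve F x D -> is_derive_curve (fun h => vec_mx (F h)) x (vec_mx D).
Proof.
move=> dF i j; rewrite -mxvecE vec_mxK.
by under eq_fun do rewrite -mxvecE vec_mxK; exact: dF.
Qed.

Lemma curve_lyap_op (s : nat) (E : 'M[R]_s) (A X : R -> 'M[R]_s) A' X' :
  is_derive_curve A x A' -> is_derive_curve X x X' ->
  is_derive_curve (fun h => lyap_op E (A h) (X h)) x
    (lyap_op E A' (X x) + lyap_op E (A x) X').
Proof.
move=> dA dX.
have dAX := curveMr E^T (curveM dA dX).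
have dXA := curveM (curveMl E dX) (curve_tr dA).
apply: curve_eqD (curveD dAX dXA) _.
by rewrite /lyap_op mulmxDl (addrC (E *m X' *m _)) addrACA.
Qed.

Lemma curve_lyap_mx (s : nat) (E : 'M[R]_s) (A : R -> 'M[R]_s) A' :
  is_derive_curve A x A' ->
  is_derive_curve (fun h => lyap_mx E (A h)) x (lyap_mx E A').
Proof.
move=> dA i j.
have dL := curve_lyap_op E dA (curve_cst x (vec_mx (delta_mx 0 i))).
rewrite linear0 addr0 in dL.
rewrite !mxE; under eq_fun do rewrite !mxE.
exact: curve_mxvec dL 0 j.
Qed.

(** The matrix of the operator stays invertible near x, so the chosen solution
    is there the unique one and is given by the inverse of that matrix. *)
Lemma curve_lyap_sol (s p : nat) (E : 'M[R]_s) (A : R -> 'M[R]_s)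
    (B : R -> 'M[R]_(s, p)) A' B' :
  let P h := xget 0 [set P | lyapP E (A h) (B h) P] in
  is_derive_curve A x A' -> is_derive_curve B x B' ->
  E \in unitmx -> stable_pencil E (A x) ->
  (\forall h \near x, lyapP E (A h) (B h) (P h)) /\
  exists P', is_derive_curve P x P'.
Proof.
move=> P dA dB Eu st; have Lu := lyap_mx_unit Eu st.
have dL := curve_lyap_mx E dA.
have Lnear := near_unitmx (curve_derivable dL) Lu.
have PE h : lyap_mx E (A h) \in unitmx ->
    P h = vec_mx (mxvec (- (B h *m (B h)^T)) *m invmx (lyap_mx E (A h))).
  move=> Lhu; apply/(lyap_mxP _ _ Lhu); rewrite /P.
  apply: (xgetPex _ (P := [set X | lyapP E (A h) (B h) X])).
  by eexists; exact/(lyap_mxP _ _ Lhu).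
split; first by apply: filterS Lnear => h Lhu; apply/(lyap_mxP _ _ Lhu)/PE.
eexists; apply: near_curve (curve_vec_mx (curveM
  (curve_mxvec (curveN (curveM dB (curve_tr dB)))) (curve_invmx dL Lu))).
by apply: filterS Lnear => h /PE.
Qed.

End LyapunovCurve.

Lemma lyapP_sym (R : realType) (s p : nat) (E A P : 'M[R]_s)
    (B : 'M[R]_(s, p)) :
  E \in unitmx -> stable_pencil E A -> lyapP E A B P -> P^T = P.
Proof.
move=> Eu st LP; have Lu := lyap_mx_unit Eu st.
have LPt : lyapP E A B P^T.
  rewrite /lyapP; have := congr1 trmx LP.
  rewrite linearD /= !trmx_mul !trmxK linearN /= trmx_mul trmxK => <-.
  by rewrite addrC !mulmxA.
by move: LPt LP; rewrite !(lyap_mxP _ _ Lu) => -> ->.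
Qed.

Lemma lyapP_uniq (R : realType) (s p : nat) (E A P P' : 'M[R]_s)
    (B : 'M[R]_(s, p)) :
  E \in unitmx -> stable_pencil E A ->
  lyapP E A B P -> lyapP E A B P' -> P = P'.
Proof.
move=> Eu st; have Lu := lyap_mx_unit Eu st.
by rewrite !(lyap_mxP _ _ Lu) => -> ->.
Qed.

Lemma lyapQP (R : realType) (s q : nat) (E A Q : 'M[R]_s) (C : 'M[R]_(q, s)) :
  lyapQ E A C Q <-> lyapP E^T A^T C^T Q.
Proof. by rewrite /lyapQ /lyapP !trmxK. Qed.

(** X |-> A^T X E + E^T X A is the adjoint of the Lyapunov operator for the
    trace pairing. *)
Lemma lyapQ_adjoint (R : realType) (s q : nat) (E A Q X : 'M[R]_s)
    (C : 'M[R]_(q, s)) :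
  lyapQ E A C Q -> \tr (C *m X *m C^T) = - \tr (Q *m lyap_op E A X).
Proof.
move=> LQ; rewrite -mulmxA mxtrace_mulC -mulmxA mxtrace_mulC.
rewrite -[C^T *m C]opprK -LQ mulNmx linearN /=; congr (- _).
rewrite /lyap_op mulmxDl mulmxDr !linearD /= addrC; congr (_ + _).
  by rewrite -!mulmxA mxtrace_mulC -!mulmxA.
by rewrite -!mulmxA mxtrace_mulC -!mulmxA.
Qed.

Lemma trace_sym2 (R : comNzRingType) (s : nat) (X : 'M[R]_s) :
  \tr (X + X^T) = 2 * \tr X.
Proof. by rewrite linearD /= mxtrace_tr mulr_natl mulr2n. Qed.

(** The derivative of the trace contains Ct P' Ct^T.  By [lyapQ_adjoint] this
    term is the pairing of Q with the Lyapunov operator at P', which the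
    differentiated equation expresses by A', B' and P only.  Symmetry of P and
    Q merges each term with its transpose, whence the factor 2. *)
Lemma derive_lyap_trace (R : realType) (x : R) (s p q : nat) (E : 'M[R]_s)
    (A : R -> 'M[R]_s) (B : R -> 'M[R]_(s, p)) (C : R -> 'M[R]_(q, s))
    A' B' C' (P Q : 'M[R]_s) :
  is_derive_curve A x A' -> is_derive_curve B x B' -> is_derive_curve C x C' ->
  E \in unitmx -> stable_pencil E (A x) ->
  lyapP E (A x) (B x) P -> lyapQ E (A x) (C x) Q ->
  is_derive x 1
    (fun h => \tr (C h *m xget 0 [set X | lyapP E (A h) (B h) X] *m (C h)^T))
    (2 * (\tr (Q *m A' *m P *m E^T) + \tr (Q *m B' *m (B x)^T)
          + \tr (C' *m P *m (C x)^T))).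
Proof.
move=> dA dB dC Eu st LP LQ.
set Ps := fun h => xget 0 [set X | lyapP E (A h) (B h) X].
have [LPs [P' dP]] := curve_lyap_sol dA dB Eu st.
have PsE : Ps x = P by apply: lyapP_uniq Eu st _ LP; exact: nbhs_singleton LPs.
have Psym := lyapP_sym Eu st LP.
have Qsym : Q^T = Q.
  apply: lyapP_sym (stable_pencil_tr st) _; rewrite ?unitmx_tr //.
  by apply/lyapQP; exact: LQ.
have LP' : lyap_op E (A x) P' =
    - (B' *m (B x)^T + (B' *m (B x)^T)^T) - (lyap_op E A' P).
  have dL := curve_lyap_op E dA dP.
  have dBB := curveN (curveM dB (curve_tr dB)).
  apply/eqP; rewrite eq_sym subr_eq eq_sym addrC -PsE trmx_mul trmxK.
  by apply/eqP; apply: curve_unique dL (near_curve _ dBB); apply: filterS LPs.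
apply: is_derive_eq (is_derive_mxtrace (curveM (curveM dC dP) (curve_tr dC))) _.
rewrite -/(Ps x) PsE mulmxDl !linearD /= (lyapQ_adjoint _ LQ) LP'.
have -> : lyap_op E A' P = A' *m P *m E^T + (A' *m P *m E^T)^T.
  by rewrite /lyap_op !trmx_mul trmxK Psym mulmxA.
have tr2 (X : 'M[R]_s) : \tr (Q *m (X + X^T)) = 2 * \tr (Q *m X).
  rewrite -trace_sym2 mulmxDr trmx_mul Qsym !linearD /=; congr (_ + _).
  by rewrite mxtrace_mulC.
rewrite mulmxBr mulmxN linearB linearN /= !tr2 !mulmxA.
rewrite -[\tr (C x *m P *m C'^T)]mxtrace_tr !trmx_mul trmxK Psym mulmxA.
by ring.
Qed.

(** * The reduced system *)

(** Identities linear in matrix products: after expansion every monomial is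
    made opaque and the remaining additive identity is checked entrywise. *)
Ltac mx_expand :=
  rewrite !(mulmxBl, mulmxBr, mulmxDl, mulmxDr, mulmxN, mulNmx, mulmxA, mul0mx,
            mulmx0);
  repeat match goal with |- context [?a *m ?b] => move: (a *m b) => ? end;
  apply/matrixP => ? ?; rewrite !mxE; ring.

Section Elimination.
Variables (R : realType) (x : R) (M r s p q : nat).
Variables (U : 'M[R]_(r, M)) (V : 'M[R]_(M, r)).
Variables (Up : 'M[R]_(s, M)) (Vp : 'M[R]_(M, s)).
Variables (AN : R -> 'M[R]_M) (BN : R -> 'M[R]_(M, p)) (CN : R -> 'M[R]_(q, M)).
Variables (A' : 'M[R]_M) (B' : 'M[R]_(M, p)) (C' : 'M[R]_(q, M)).
Hypotheses (dA : is_derive_curve AN x A') (dB : is_derive_curve BN x B').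
Hypothesis dC : is_derive_curve CN x C'.
Let A22 := U *m AN x *m V.
Hypothesis A22u : A22 \in unitmx.
Let L := Up - Up *m AN x *m V *m invmx A22 *m U.
Let K := Vp - V *m invmx A22 *m (U *m AN x *m Vp).
Let W := V *m invmx A22 *m U.

Let dPA (k l : nat) (Z : 'M[R]_(k, M)) (Y : 'M[R]_(M, l)) :
  is_derive_curve (fun h => Z *m AN h *m Y) x (Z *m A' *m Y).
Proof. exact: curveMr (curveMl Z dA). Qed.

Let dinv := curve_invmx (dPA U V) A22u.

Lemma curve_redA :
  is_derive_curve (fun h => redA U V Up Vp (AN h)) x (L *m A' *m K).
Proof.
apply: curve_eqD (curveB (dPA Up Vp)
  (curveM (curveM (dPA Up V) dinv) (dPA U Vp))) _.
rewrite -/A22 /L /K; mx_expand.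
Qed.

Lemma curve_redB :
  is_derive_curve (fun h => redB U V Up (AN h) (BN h)) x
    (L *m B' - L *m A' *m W *m BN x).
Proof.
apply: curve_eqD (curveB (curveMl Up dB)
  (curveM (curveM (dPA Up V) dinv) (curveMl U dB))) _.
rewrite -/A22 /L /W; mx_expand.
Qed.

Lemma curve_redC :
  is_derive_curve (fun h => redC U V Vp (AN h) (CN h)) x
    (C' *m K - CN x *m W *m A' *m K).
Proof.
apply: curve_eqD (curveB (curveMr Vp dC)
  (curveM (curveM (curveMr V dC) dinv) (dPA U Vp))) _.
rewrite -/A22 /K /W; mx_expand.
Qed.

(** Substituting the factored derivatives of At, Bt, Ct into
    [derive_lyap_trace] and moving AN', BN', CN' to the front of each trace by
    cyclicity collects the coefficient of AN' to DS. *)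
Lemma derive_reduced_norm_fixE (E P Q : 'M[R]_s) :
  let At := redA U V Up Vp (AN x) in
  let Bt := redB U V Up (AN x) (BN x) in
  let Ct := redC U V Vp (AN x) (CN x) in
  let QU := Q *m L in
  let PV := K *m P in
  let DS := PV *m E^T *m QU - W *m BN x *m Bt^T *m QU
            - PV *m Ct^T *m CN x *m W in
  E \in unitmx -> stable_pencil E At ->
  lyapP E At Bt P -> lyapQ E At Ct Q ->
  is_derive x 1
    (fun h => \tr (redC U V Vp (AN h) (CN h) *m
       xget 0 [set X | lyapP E (redA U V Up Vp (AN h))
                               (redB U V Up (AN h) (BN h)) X] *m
       (redC U V Vp (AN h) (CN h))^T))
    (2 * (\tr (A' *m DS) + \tr (B' *m (Bt^T *m QU))
          + \tr (C' *m (PV *m Ct^T)))).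
Proof.
move=> At Bt Ct QU PV DS Eu st LP LQ.
apply: is_derive_eq
  (derive_lyap_trace curve_redA curve_redB curve_redC Eu st LP LQ) _.
congr (2 * _); rewrite -/Bt -/Ct.
have -> : \tr (Q *m (L *m A' *m K) *m P *m E^T) = \tr (A' *m (PV *m E^T *m QU)).
  transitivity (\tr (QU *m (A' *m (PV *m E^T)))).
    by rewrite /QU /PV !mulmxA.
  by rewrite mxtrace_mulC !mulmxA.
have -> : \tr (Q *m (L *m B' - L *m A' *m W *m BN x) *m Bt^T)
    = \tr (B' *m (Bt^T *m QU)) - \tr (A' *m (W *m BN x *m Bt^T *m QU)).
  rewrite mulmxBr mulmxBl linearB /=; congr (_ - _).
    transitivity (\tr (QU *m (B' *m Bt^T))); first by rewrite /QU !mulmxA.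
    by rewrite mxtrace_mulC !mulmxA.
  transitivity (\tr (QU *m (A' *m (W *m BN x *m Bt^T)))).
    by rewrite /QU !mulmxA.
  by rewrite mxtrace_mulC !mulmxA.
have -> : \tr ((C' *m K - CN x *m W *m A' *m K) *m P *m Ct^T)
    = \tr (C' *m (PV *m Ct^T)) - \tr (A' *m (PV *m Ct^T *m CN x *m W)).
  rewrite 2!mulmxBl linearB /=; congr (_ - _).
    by rewrite /PV !mulmxA.
  transitivity (\tr (CN x *m W *m (A' *m (PV *m Ct^T)))).
    by rewrite /PV !mulmxA.
  by rewrite mxtrace_mulC !mulmxA.
rewrite /DS 2!mulmxBr 2!(raddfB (@mxtrace R M)) /=.
move: (\tr (A' *m _)) (\tr (A' *m _)) (\tr (A' *m _)) => a1 a2 a3.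
move: (\tr _) (\tr _) => b1 c1; ring.
Qed.

End Elimination.

(** gamma^2 as a function of EN, AN, BN, CN; [gamma2] is its composition with
    the discretization, by conversion. *)
Definition reduced_norm (R : realType) (M r s p q : nat)
    (U : 'M[R]_(r, M)) (V : 'M[R]_(M, r))
    (Up : 'M[R]_(s, M)) (Vp : 'M[R]_(M, s))
    (EN AN : 'M[R]_M) (BN : 'M[R]_(M, p)) (CN : 'M[R]_(q, M)) : R :=
  let Ct := redC U V Vp AN CN in
  let P := xget 0 [set P | lyapP (Up *m EN *m Vp) (redA U V Up Vp AN)
                                 (redB U V Up AN BN) P] in
  \tr (Ct *m P *m Ct^T).

(** EN is asked to be constant near x only: as tau_m moves, it keeps its value
    as long as the scaling factor tau_m does not vanish. *)
Lemma derive_reduced_norm (R : realType) (M r s p q : nat)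
    (U : 'M[R]_(r, M)) (V : 'M[R]_(M, r))
    (Up : 'M[R]_(s, M)) (Vp : 'M[R]_(M, s))
    (EN AN : 'M[R]_M) (BN : 'M[R]_(M, p)) (CN : 'M[R]_(q, M)) (P Q : 'M[R]_s) :
  let E11 := Up *m EN *m Vp in
  let A22 := U *m AN *m V in
  let At := redA U V Up Vp AN in
  let Bt := redB U V Up AN BN in
  let Ct := redC U V Vp AN CN in
  let QU := Q *m (Up - Up *m AN *m V *m invmx A22 *m U) in
  let PV := (Vp - V *m invmx A22 *m (U *m AN *m Vp)) *m P in
  let W := V *m invmx A22 *m U in
  let DS := PV *m E11^T *m QU - W *m BN *m Bt^T *m QU
            - PV *m Ct^T *m CN *m W in
  A22 \in unitmx -> E11 \in unitmx -> stable_pencil E11 At ->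
  lyapP E11 At Bt P -> lyapQ E11 At Ct Q ->
  forall (x : R) ENc ANc BNc CNc A' B' C',
  (\forall h \near x, ENc h = EN) -> ANc x = AN -> BNc x = BN -> CNc x = CN ->
  is_derive_curve ANc x A' -> is_derive_curve BNc x B' ->
  is_derive_curve CNc x C' ->
  is_derive x 1
    (fun h => reduced_norm U V Up Vp (ENc h) (ANc h) (BNc h) (CNc h))
    (2 * (\tr (A' *m DS) + \tr (B' *m (Bt^T *m QU))
          + \tr (C' *m (PV *m Ct^T)))).
Proof.
move=> E11 A22 At Bt Ct QU PV W DS A22u E11u st LP LQ.
move=> x ENc ANc BNc CNc A' B' C' nearE AE BE CE dA dB dC; subst AN BN CN.
apply: near_eq_is_derive (derive_reduced_norm_fixE dA dB dC A22u E11u st LP LQ).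
by apply: filterS nearE => h Eh; rewrite /reduced_norm Eh.
Qed.

(** * Dependence of the coordinate matrices on the delays *)

Lemma horner_pscale (R : fieldType) (t a : R) (f : {poly R}) :
  (pscale t f).[a] = f.[t^-1 * a].
Proof. by rewrite /pscale horner_comp !hornerE. Qed.

Lemma pscaleVK (R : fieldType) (t : R) : t != 0 ->
  cancel (pscale t) (pscale t^-1).
Proof.
move=> t0 f; rewrite /pscale -comp_polyA comp_polyZ comp_polyX scalerA invrK.
by rewrite mulVf // scale1r comp_polyXr.
Qed.

Lemma deriv_pscale (R : fieldType) (t : R) (f : {poly R}) :
  (pscale t f)^`() = t^-1 *: pscale t f^`().
Proof.
by rewrite /pscale deriv_comp derivZ derivX alg_polyC mulrC mul_polyC.
Qed.

Lemma vscale_linear (R : fieldType) (n : nat) (t : R) : linear (@vscale R n t).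
Proof.
by move=> a xi eta; apply/ffunP => i; rewrite !ffunE /pscale linearP.
Qed.

HB.instance Definition _ (R : fieldType) (n : nat) (t : R) :=
  GRing.isLinear.Build R (vpoly R n) (vpoly R n) _ (@vscale R n t)
    (vscale_linear t).

Lemma vscale_inj (R : fieldType) (n : nat) (t : R) : t != 0 ->
  injective (@vscale R n t).
Proof.
move=> t0 xi eta /ffunP eq_s; apply/ffunP => i; apply: (can_inj (pscaleVK t0)).
by have := eq_s i; rewrite !ffunE.
Qed.

(** Coordinates are unchanged when basis and operator are rescaled together,
    because rescaling is an injective linear map. *)
Lemma op_mx_vscale (R : realType) (n c d : nat) (t : R)
    (b : 'I_c -> vpoly R n) (b' : 'I_d -> vpoly R n)
    (L L0 : vpoly R n -> vpoly R n) :
  t != 0 -> (forall xi, L (vscale t xi) = vscale t (L0 xi)) ->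
  op_mx (vscale t \o b) (vscale t \o b') L = op_mx b b' L0.
Proof.
move=> t0 LL0; rewrite /op_mx; congr xget; apply/seteqP.
have sumE (K : 'M[R]_(d, c)) j :
    \sum_i K i j *: vscale t (b' i) = vscale t (\sum_i K i j *: b' i).
  by rewrite linear_sum; apply: eq_bigr => i _; rewrite linearZ.
split=> K /= KL j; have := KL j; rewrite /= LL0 sumE.
  exact: vscale_inj.
by move=> ->.
Qed.

Lemma inner_pscale (R : realType)
    (mu : {finite_measure set (measurableTypeR R) -> \bar R}) (t : R)
    (f g : {poly R}) : t != 0 ->
  inner mu t (pscale t f) (pscale t g) = inner mu 1 f g.
Proof.
move=> t0; congr Rintegral; apply/funext => x.
by rewrite !horner_pscale mulrA mulVf // !mul1r.
Qed.

(** The inner product on [-t, 0] is the scaled one, so that the truncation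
    commutes with rescaling. *)
Lemma trunc_mx_cst (R : realType) (n N : nat)
    (mu : {finite_measure set (measurableTypeR R) -> \bar R})
    (psi : 'I_N.+1 -> {poly R})
    (b : 'I_(n + n * N) -> vpoly R n) (b' : 'I_(n * N) -> vpoly R n) (t u : R) :
  t != 0 -> u != 0 -> trunc_mx mu psi b b' t = trunc_mx mu psi b b' u.
Proof.
pose T0 (xi : vpoly R n) : vpoly R n := [ffun i => xi i -
  (inner mu 1 (xi i) (psi ord_max) / inner mu 1 (psi ord_max) (psi ord_max))
    *: psi ord_max].
have trE v : v != 0 -> trunc_mx mu psi b b' v = op_mx b b' T0.
  move=> v0; apply: op_mx_vscale => // xi; apply/ffunP => i.
  by rewrite !ffunE !inner_pscale // /pscale comp_polyB comp_polyZ.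
by move=> t0 u0; rewrite !trE.
Qed.

(** Existence and uniqueness of coordinates in the basis b' pin down the matrix
    that op_mx chooses. *)
Lemma op_mxP (R : realType) (V W : lmodType R) (c d : nat) (S : set W)
    (b : 'I_c -> V) (b' : 'I_d -> W) (L : V -> W) (K : 'M[R]_(d, c)) :
  is_basis S b' -> (forall j, S (L (b j))) ->
  op_mx b b' L = K <-> forall j, L (b j) = \sum_i K i j *: b' i.
Proof.
move=> [_ coord] SL.
pose D (K' : 'M[R]_(d, c)) := forall j, L (b j) = \sum_i K' i j *: b' i.
have D_uniq K1 K2 : D K1 -> D K2 -> K1 = K2.
  move=> D1 D2; apply/matrixP => i j.
  have [k [_ k_uniq]] := coord _ (SL j).
  have colE K' : D K' -> k = \row_i K' i j.
    move=> /(_ j) DK'; apply: k_uniq; rewrite DK'.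
    by apply: eq_bigr => i' _; rewrite mxE.
  have := colE _ D1; rewrite (colE _ D2) => /matrixP /(_ ord0 i).
  by rewrite !mxE.
have /boolp.choice[k kE] : forall j, exists k : 'rV[R]_d,
    L (b j) = \sum_i k ord0 i *: b' i.
  by move=> j; have [k [kE _]] := coord _ (SL j); exists k.
have DK : D (\matrix_(i, j) k j ord0 i).
  by move=> j; rewrite kE; apply: eq_bigr => i _; rewrite mxE.
have Dop : D (op_mx b b' L) by apply: (xgetPex _ (P := D)); eexists; exact: DK.
by split=> [<-|DK'] //; exact: D_uniq.
Qed.

Section ScaledBasis.
Variables (R : realType) (n N : nat).
Variables (b : 'I_(n + n * N) -> vpoly R n) (b' : 'I_(n * N) -> vpoly R n).

Lemma deriv_mxE (t : R) : (0 < N)%N -> t != 0 ->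
  is_basis (@vpoly_deg_le R n N) b -> is_basis (@vpoly_deg_le R n N.-1) b' ->
  deriv_mx b b' t = t^-1 *: op_mx b b' (@deriv_op R n).
Proof.
move=> N0 t0 [degb _] basb'.
have deg_deriv j : vpoly_deg_le N.-1 (deriv_op (b j)).
  move=> i; rewrite ffunE prednK //.
  have [->|p0] := eqVneq (b j i) 0; first by rewrite deriv0 size_poly0.
  by rewrite -ltnS (leq_trans (lt_size_deriv p0)) // degb.
have DE : forall j, deriv_op (b j)
    = \sum_i op_mx b b' (@deriv_op R n) i j *: b' i.
  exact/(op_mxP _ basb' deg_deriv).
rewrite /deriv_mx
  (@op_mx_vscale _ _ _ _ t _ _ _ (fun xi => t^-1 *: deriv_op xi)) //.
  apply/(op_mxP _ basb') => j.
    move=> i; rewrite ffunE (leq_trans (size_scale_leq _ _)) //.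
    exact: deg_deriv.
  rewrite DE scaler_sumr; apply: eq_bigr => i _.
  by rewrite mxE scalerA.
move=> xi; apply/ffunP => i; rewrite !ffunE deriv_pscale.
by rewrite /pscale comp_polyZ.
Qed.

Lemma eval_mxE (t a : R) i j : eval_mx b t a i j = (b j i).[t^-1 * a].
Proof. by rewrite !mxE /= ffunE horner_pscale. Qed.

Lemma eval_deriv_mxE (t a : R) i j :
  eval_deriv_mx b t a i j = t^-1 * (b j i)^`().[t^-1 * a].
Proof. by rewrite !mxE /= !ffunE deriv_pscale hornerZ horner_pscale. Qed.

Lemma eval_mx0 (t u : R) : eval_mx b t 0 = eval_mx b u 0.
Proof. by apply/matrixP => i j; rewrite !eval_mxE !mulr0. Qed.

(** The basis function b (theta / t) is sampled at theta = a, hence b at a / t,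
    and the scaled derivative carries a factor 1 / t, compensated by t. *)
Lemma curve_eval_mx (t a : R -> R) (x u' : R) :
  is_derive x 1 (fun h => (t h)^-1 * a h) u' -> t x != 0 ->
  is_derive_curve (fun h => eval_mx b (t h) (a h)) x
    ((t x * u') *: eval_deriv_mx b (t x) (a x)).
Proof.
move=> du tx0 i j; rewrite mxE eval_deriv_mxE.
under eq_fun do rewrite eval_mxE.
apply: is_derive_eq (is_derive1_comp (f := horner (b j i)) _ du) _.
by rewrite mulrA [X in _ = X * _]mulrAC mulfV // mul1r mulrC.
Qed.

End ScaledBasis.

(** * The gradient formulas *)

Lemma mxtrace_delta (R : comNzRingType) (k l : nat) (i : 'I_k) (j : 'I_l)
    (X : 'M[R]_(l, k)) : \tr (delta_mx i j *m X) = X j i.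
Proof.
rewrite /mxtrace (bigD1 i) //= big1 ?addr0 => [|a ai]; rewrite !mxE.
  rewrite (bigD1 j) //= mxE !eqxx mul1r big1 ?addr0 // => c cj.
  by rewrite mxE (negbTE cj) andbF mul0r.
by rewrite big1 // => c _; rewrite mxE (negbTE ai) mul0r.
Qed.

Lemma mxtrace_col_mx (R : comNzRingType) (k l : nat)
    (X : 'M[R]_(k, k + l)) (Y : 'M[R]_(l, k + l)) (Z : 'M[R]_(k + l)) :
  \tr (col_mx X Y *m Z) =
  \tr (X *m Z *m col_mx 1%:M 0) + \tr (Y *m Z *m col_mx 0 1%:M).
Proof.
have -> : col_mx X Y = col_mx 1%:M 0 *m X + col_mx 0 1%:M *m Y.
  by rewrite !mul_col_mx !mul1mx !mul0mx add_col_mx addr0 add0r.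
rewrite mulmxDl linearD /=; congr (_ + _).
  by rewrite -mulmxA mxtrace_mulC.
by rewrite -mulmxA mxtrace_mulC.
Qed.

Lemma curve_line (R : realType) (k l : nat) (X D : 'M[R]_(k, l)) :
  is_derive_curve (fun h => X + h *: D) 0 D.
Proof.
move=> i j; under eq_fun do rewrite !mxE.
have dh : is_derive (0 : R) 1 (fun h : R => h * D i j) (D i j).
  apply: is_derive_eq (is_deriveM (is_derive_id (0 : R) (1 : R))
    (is_derive_cst (D i j) (0 : R) (1 : R))) _.
  by rewrite scaler0 add0r /GRing.scale /= mulr1.
have dX := is_derive_cst (X i j) (0 : R) (1 : R).
by apply: is_derive_eq (is_deriveD dX dh) _; rewrite add0r.
Qed.

Lemma upd_id (m : nat) (T : Type) (f : 'I_m -> T) k : upd f k (f k) = f.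
Proof. by apply/funext => j; rewrite /upd; case: eqP => [->|]. Qed.

Theorem mainTheorem5 (R : realType) (n p q m N r s : nat)
    (E : 'M[R]_n) (A : 'I_m.+1 -> 'M[R]_n) (tau : 'I_m.+1 -> R)
    (B : 'M[R]_(n, p)) (C : 'M[R]_(q, n))
    (mu : {finite_measure set (measurableTypeR R) -> \bar R})
    (psi : 'I_N.+1 -> {poly R})
    (b : 'I_(n + n * N) -> vpoly R n) (b' : 'I_(n * N) -> vpoly R n)
    (U : 'M[R]_(r, n + n * N)) (V : 'M[R]_(n + n * N, r))
    (Up : 'M[R]_(s, n + n * N)) (Vp : 'M[R]_(n + n * N, s))
    (P Q : 'M[R]_s) :
  let taum := tau ord_max in
  let EN := tauE mu psi b b' E taum in
  let AN := tauA b b' A tau in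
  let BN := tauB N B in
  let CN := tauC b C taum in
  let E11 := Up *m EN *m Vp in
  let A12 := Up *m AN *m V in
  let A21 := U *m AN *m Vp in
  let A22 := U *m AN *m V in
  let At := redA U V Up Vp AN in
  let Bt := redB U V Up AN BN in
  let Ct := redC U V Vp AN CN in
  let QU := Q *m (Up - A12 *m invmx A22 *m U) in
  let PV := (Vp - V *m invmx A22 *m A21) *m P in
  let W := V *m invmx A22 *m U in
  let DS := PV *m E11^T *m QU - W *m BN *m Bt^T *m QU
            - PV *m Ct^T *m CN *m W in
  let I0 : 'M[R]_(n + n * N, n) := col_mx 1%:M 0 in
  let OI : 'M[R]_(n + n * N, n * N) := col_mx 0 1%:M in
  let g2 := @gamma2 R n p q m N r s mu psi b b' U V Up Vp E in
  let g2tau := fun k (t : R) => g2 A (upd tau k t) B C in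
  (0 < m)%N -> (0 < N)%N ->
  tau ord0 = 0 -> (forall i j : 'I_m.+1, (i < j)%N -> tau i < tau j) ->
  index_le1 E (A ord0) ->
  orthogonal_family mu psi ->
  is_basis (@vpoly_deg_le R n N) b ->
  is_basis (@vpoly_deg_le R n N.-1) b' ->
  ker_basis EN V -> is_diag_mx (V^T *m V) ->
  ker_basis EN^T U^T -> is_diag_mx (U *m U^T) ->
  orthc_basis V Vp -> orthc_basis U^T Up^T ->
  A22 \in unitmx ->
  (forall lam : R[i], gen_eigenvalue E11 At lam -> complex.Re lam < 0) ->
  lyapP E11 At Bt P -> lyapQ E11 At Ct Q ->
  [/\ forall k : 'I_m.+1,
        is_mx_derive (fun X => g2 (upd A k X) tau B C) (A k)
          (2 *: (I0^T *m DS^T *m (eval_mx b taum (- tau k))^T)),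
      forall k : 'I_m.+1, (0 < k < m)%N ->
        is_derive (tau k) (1 : R) (g2tau k)
          (- 2 * \tr (A k *m eval_deriv_mx b taum (- tau k) *m DS *m I0)),
      is_derive taum (1 : R) (g2tau ord_max)
        (- 2 * \tr (taum^-1 *: deriv_mx b b' taum *m DS *m OI)
         - \sum_(k < m.+1 | (0 < k < m)%N)
             tau k / taum * derive1 (g2tau k) (tau k)),
      is_mx_derive (fun X => g2 A tau X C) B
        (2 *: (I0^T *m QU^T *m Bt)) &
      is_mx_derive (fun X => g2 A tau B X) C
        (2 *: (Ct *m PV^T *m (eval_mx b taum 0)^T))].

Proof.
move=> taum EN AN BN CN E11 A12 A21 A22 At Bt Ct QU PV W DS I0 OI g2 g2tau.
move=> m0 N0 tau0 tau_incr _ _ basb basb' kerV _ kerU _ orthV orthU A22u.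
move=> /stable_pencilP stab LP LQ.
have E11u : E11 \in unitmx by exact: compression_unit kerV kerU orthV orthU.
have taum0 : taum != 0.
  by rewrite gt_eqF // -tau0; apply: tau_incr.
have chain (x : R) ENc ANc BNc CNc A' B' C' :
    (\forall h \near x, ENc h = EN) -> ANc x = AN -> BNc x = BN -> CNc x = CN ->
    is_derive_curve ANc x A' -> is_derive_curve BNc x B' ->
    is_derive_curve CNc x C' ->
    is_derive x (1 : R)
      (fun h => reduced_norm U V Up Vp (ENc h) (ANc h) (BNc h) (CNc h))
      (2 * (\tr (A' *m DS) + \tr (B' *m (Bt^T *m QU))
            + \tr (C' *m (PV *m Ct^T)))).
  exact: (derive_reduced_norm A22u E11u stab LP LQ).
have trI0 (X : 'M[R]_(n, n + n * N)) (Z : 'M[R]_(n + n * N)) :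
    \tr (col_mx X 0 *m Z) = \tr (X *m Z *m I0).
  by rewrite mxtrace_col_mx !mul0mx mxtrace0 addr0.
have cstE : \forall h \near (0 : R), EN = EN.
  exact: filterE.
have dtau (k : 'I_m.+1) : (0 < k < m)%N -> is_derive (tau k) (1 : R) (g2tau k)
    (- 2 * \tr (A k *m eval_deriv_mx b taum (- tau k) *m DS *m I0)).
  move=> /andP[k0 km].
  have kmax : (ord_max == k) = false by rewrite -val_eqE /= gtn_eqF.
  have upd_max t : upd tau k t ord_max = taum by rewrite /upd kmax.
  have dAN : is_derive_curve (fun t => tauA b b' A (upd tau k t)) (tau k)
      (col_mx (\sum_j (if j == k then - (A k *m eval_deriv_mx b taum (- tau k))
                       else 0)) 0).
    rewrite /tauA; under eq_fun do rewrite upd_max.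
    apply: curve_col_mx (curve_cst _ _); apply: curve_sum => j _.
    rewrite /upd; case: eqP => [->|_]; last exact: curve_cst.
    rewrite -mulmxN; apply: curveMl.
    have du : is_derive (tau k) 1 (fun h => taum^-1 * - h) (- taum^-1).
      apply: is_derive_eq (is_deriveZ taum^-1 (is_deriveNid (tau k) (1 : R))) _.
      by rewrite scalerN /GRing.scale /= mulr1.
    apply: curve_eqD (curve_eval_mx b (t := fun=> taum) du taum0) _.
    by rewrite /= mulrN mulfV // scaleN1r.
  rewrite -big_mkcond big_pred1_eq in dAN.
  apply: is_derive_eq (chain _
    (fun t => tauE mu psi b b' E (upd tau k t ord_max))
    _ (fun=> BN)
    (fun t => tauC b C (upd tau k t ord_max)) _ 0 0 _ _ _ _ dAN _ _) _.
  - by apply: filterE => t; rewrite upd_max.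
  - by rewrite upd_id.
  - by [].
  - by rewrite upd_max.
  - exact: curve_cst.
  - by under eq_fun do rewrite upd_max; exact: curve_cst.
  rewrite !mul0mx !mxtrace0 !addr0 trI0 !mulNmx linearN /=.
  by rewrite mulrN mulNr.
split.
- move=> k i j.
  have dAN : is_derive_curve
      (fun h => tauA b b' (upd A k (A k + h *: delta_mx i j)) tau) 0
      (col_mx (\sum_l (if l == k then delta_mx i j *m eval_mx b taum (- tau k)
                       else 0)) 0).
    apply: curve_col_mx (curve_cst _ _); apply: curve_sum => l _.
    rewrite /upd; case: eqP => [->|_]; last exact: curve_cst.
    exact: curveMr (curve_line _ _).
  rewrite -big_mkcond big_pred1_eq in dAN.
  apply: is_derive_eq (chain _ (fun=> EN) _ (fun=> BN) (fun=> CN) _ 0 0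
    cstE _ erefl erefl dAN (curve_cst _ _) (curve_cst _ _)) _.
    by rewrite scale0r addr0 upd_id.
  rewrite !mul0mx !mxtrace0 !addr0 trI0 -!mulmxA mxtrace_delta mulmxA.
  by rewrite -!trmx_mul [RHS]mxE [_^T i j]mxE.
- exact: dtau.
- (* Moving tau_m also rescales the basis: the points -tau_j with 0 < j < m
     slide in the coordinates of [-1, 0], and the derivative scales by 1/t. *)
  set sumD := \sum_(k < m.+1 | (0 < k < m)%N) (tau k / taum) *:
    (A k *m eval_deriv_mx b taum (- tau k)).
  have upd_max t : upd tau ord_max t ord_max = t by rewrite /upd eqxx.
  have near_neq0 : \forall t \near taum, t != 0.
    exact: (cvgr_neq0 _ (f := id) cvg_id taum0).
  have dinv : is_derive taum 1 (fun t : R => t^-1) (- taum^-1 * taum^-1).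
    apply: is_derive_eq (is_deriveV taum0 (is_derive_id taum (1 : R))) _.
    by rewrite /GRing.scale /= mulr1 -exprVn expr2 mulNr.
  have dAN : is_derive_curve (fun t => tauA b b' A (upd tau ord_max t)) taum
      (col_mx sumD (- taum^-1 *: deriv_mx b b' taum)).
    rewrite /tauA; under eq_fun do rewrite upd_max.
    apply: curve_col_mx.
      rewrite /sumD big_mkcond; apply: curve_sum => j _; rewrite /upd.
      have [->|jmax] := eqVneq j ord_max.
        rewrite ltnn andbF.
        (* The point -t is the image of -1 under the scaling, so this
           evaluation does not move with t. *)
        have du : is_derive taum 1 (fun t : R => t^-1 * - t) 0.
          apply: near_eq_is_derive (is_derive_cst (-1 : R) taum (1 : R)).
          by apply: filterS near_neq0 => t t0; rewrite mulrN mulVf.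
        apply: curve_eqD (curveMl (A ord_max)
          (curve_eval_mx b (t := id) (a := -%R) du taum0)) _.
        by rewrite mulr0 scale0r mulmx0.
      have du : is_derive taum 1 (fun t : R => t^-1 * - tau j)
          (tau j / taum / taum).
        apply: is_derive_eq (is_deriveM dinv
          (is_derive_cst (- tau j) taum (1 : R))) _.
        by rewrite scaler0 add0r /GRing.scale /= !mulNr mulrN opprK mulrA.
      apply: curve_eqD (curveMl (A j)
        (curve_eval_mx b (t := id) (a := fun=> - tau j) du taum0)) _.
      rewrite /= mulrCA mulfV // mulr1 -scalemxAr.
      have -> : (j < m)%N by rewrite ltn_neqAle jmax -ltnS ltn_ord.
      (* The term j = 0 is absent from the sum; it vanishes as tau_0 = 0. *)
      case: posnP => // j0; rewrite (_ : j = ord0) ?tau0 ?mul0r ?scale0r //.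
      exact: val_inj.
    apply: (near_curve (F := fun t => t^-1 *: op_mx b b' (@deriv_op R n))).
      by apply: filterS near_neq0 => t t0; rewrite deriv_mxE.
    rewrite deriv_mxE // => i j; rewrite scalerA !mxE.
    under eq_fun do rewrite mxE.
    apply: is_derive_eq (is_deriveM dinv
      (is_derive_cst (op_mx b b' (@deriv_op R n) i j) taum (1 : R))) _.
    by rewrite scaler0 add0r /GRing.scale /= mulrC.
  apply: is_derive_eq (chain _
    (fun t => tauE mu psi b b' E (upd tau ord_max t ord_max))
    _ (fun=> BN)
    (fun t => tauC b C (upd tau ord_max t ord_max)) _ 0 0 _ _ _ _ dAN _ _) _.
  - apply: filterS near_neq0 => t t0.
    by rewrite upd_max /EN /tauE (eval_mx0 b t taum)
      (trunc_mx_cst mu psi b b' t0 taum0).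
  - by rewrite upd_id.
  - by [].
  - by rewrite upd_max.
  - exact: curve_cst.
  - under eq_fun do rewrite upd_max /tauC (eval_mx0 b _ taum).
    exact: curve_cst.
  rewrite !mul0mx !mxtrace0 !addr0 mxtrace_col_mx mulrDr addrC; congr (_ + _).
    by rewrite scaleNr !mulNmx linearN mulrN mulNr.
  rewrite /sumD !mulmx_suml linear_sum mulr_sumr -sumrN; apply: eq_bigr => k km.
  rewrite derive1E (@derive_val _ _ _ _ _ _ _ (dtau k km)).
  rewrite -!scalemxAl linearZ /=; ring.
- move=> i j.
  have dBN : is_derive_curve (fun h => tauB N (B + h *: delta_mx i j)) 0
      (col_mx (delta_mx i j) 0).
    exact: curve_col_mx (curve_line _ _) (curve_cst _ _).
  apply: is_derive_eq (chain _ (fun=> EN) (fun=> AN) _ (fun=> CN) 0 _ 0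
    cstE erefl _ erefl (curve_cst _ _) dBN (curve_cst _ _)) _.
    by rewrite scale0r addr0.
  rewrite !mul0mx !mxtrace0 addr0 add0r.
  have -> : col_mx (delta_mx i j) 0 = I0 *m delta_mx i j.
    by rewrite mul_col_mx mul1mx mul0mx.
  have -> : I0^T *m QU^T *m Bt = (Bt^T *m QU *m I0)^T.
    by rewrite !trmx_mul trmxK mulmxA.
  rewrite -mulmxA mxtrace_mulC -!mulmxA mxtrace_delta.
  by rewrite [RHS]mxE [_^T i j]mxE.
- move=> i j.
  have dCN : is_derive_curve (fun h => tauC b (C + h *: delta_mx i j) taum) 0
      (delta_mx i j *m eval_mx b taum 0).
    exact: curveMr (curve_line _ _).
  apply: is_derive_eq (chain _ (fun=> EN) (fun=> AN) (fun=> BN) _ 0 0 _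
    cstE erefl erefl _ (curve_cst _ _) (curve_cst _ _) dCN) _.
    by rewrite scale0r addr0.
  rewrite !mul0mx !mxtrace0 !add0r -mulmxA mxtrace_delta.
  have -> : Ct *m PV^T *m (eval_mx b taum 0)^T
      = (eval_mx b taum 0 *m (PV *m Ct^T))^T.
    by rewrite !trmx_mul trmxK.
  by rewrite [RHS]mxE [_^T i j]mxE.
Qed.
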